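(* Let $X$ be a real Banach space which is an Asplund space or is separable. Then the following are equivalent: (a) $X^*$ is the closed linear span of the w*-strongly exposed points of $B(X^* )$. (b) $X^*$ is the closed linear span of the w*-denting points of $B(X^* )$. (c) $X^*$ is the closed linear span of the w*-SCS points of $B(X^* )$. (d) $X$ has the Ball Generated Property (BGP). (e) $X$ is nicely smooth. Moreover, for such $X$, all of the following conditions are equivalent (to each other, and hence, since one of them is (e), to (a)--(e)): (i) $X^*$ is the closed linear span of the w*-weak points of continuity of $B(X^* )$; (ii) any two distinct points in $X^{**}$ are separated by disjoint closed balls of $X^{**}$ having centres in $X$ (each ball containing one of the two points); (iii) $X$ is nicely smooth; (iv) for every norm dense set $A\subseteq S(X)$ and every support mapping $\phi$, the set $\phi(A)$ separates points of $X^{**}$.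
   Context: All Banach spaces are real. $B(X)$ and $S(X)$ denote the closed unit ball and unit sphere of $X$; $X$ is identified with its canonical image in $X^{**}$. A set $A\subseteq B(X^* )$ is a norming set for $X$ if $\|x\|=\sup\{x^*(x):x^*\in A\}$ for all $x\in X$. A closed subspace $F\subseteq X^*$ is a norming subspace if $B(F)$ is a norming set for $X$. $X$ is nicely smooth if $X^*$ contains no proper norming (closed) subspace. $X$ has the BGP if every closed bounded convex set in $X$ is ball-generated, i.e., an intersection of sets each of which is a finite union of closed balls. A w*-slice of a bounded convex set $K\subseteq X^*$ is a nonempty set of the form $\{f\in K: f(x)>\alpha\}$ with $x\in X$, $\alpha\in\mathbb{R}$. A point $x_0^*$ of $K$ is: a w*-denting point if for every $\varepsilon>0$ it lies in a w*-slice of $K$ of norm diameter less than $\varepsilon$; a w*-SCS point if for every $\varepsilon>0$ there exist w*-slices $S_1,\ldots,S_n$ of $K$ and a convex combination $S=\sum_{i=1}^n\lambda_iS_i$ ($\lambda_i\ge 0$, $\sum\lambda_i=1$) with $x_0^*\in S$ and $\operatorname{diam}(S)<\varepsilon$; a w*-strongly exposed point if there is $x\in X$ with $x_0^*(x)=\sup_{f\in K}f(x)$ such that $\|f_n-x_0^*\|\to0$ whenever $f_n\in K$ and $f_n(x)\to x_0^*(x)$. A point $f\in B(X^* )$ is a w*-weak PC (point of continuity) of $B(X^* )$ if the identity map $(B(X^* ),w^* )\to(B(X^* ),\text{weak})$ is continuous at $f$. For $x\in S(X)$ let $D(x)=\{f\in S(X^* ):f(x)=1\}$; a support mapping is any map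 $\phi:S(X)\to S(X^* )$ with $\phi(x)\in D(x)$ for all $x\in S(X)$. *)

(* Defs.v *)
From HB Require Import structures.
From mathcomp Require Import all_boot all_order all_algebra.
From mathcomp Require Import all_classical all_reals all_analysis.
From mathcomp Require Import borel_hierarchy.

Set Implicit Arguments.
Unset Strict Implicit.
Unset Printing Implicit Defensive.

Import Order.TTheory GRing.Theory Num.Def Num.Theory.
Import numFieldNormedType.Exports.

Local Open Scope classical_set_scope.
Local Open Scope ring_scope.

Definition unit_ball (R : realType) (V : normedModType R) : set V :=
  [set v | `|v| <= 1].
Arguments unit_ball {R} V.

Definition unit_sphere (R : realType) (V : normedModType R) : set V :=
  [set v | `|v| = 1].
Arguments unit_sphere {R} V.

Section dual_space.
Context {R : realType} (X : normedModType R).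

Definition dual_pred : pred (X -> R^o) :=
  fun f => `[< linear f /\ continuous f >].

Record dual := Dual { dual_val :> X -> R^o ; _ : dual_pred dual_val }.

HB.instance Definition _ := [isSub for dual_val].
HB.instance Definition _ := [Choice of dual by <:].

Lemma dual_pred_submod_closed : submod_closed (dual_pred : {pred (X -> R^o)}).
Proof.
split.
  rewrite unfold_in; apply/asboolP; split; last by move=> x; exact: cvg_cst.
  by move=> a u v; rewrite /= scaler0 addr0.
move=> a f g; rewrite !unfold_in.
move=> /asboolP[lf cf] /asboolP[lg cg]; apply/asboolP; split.
  move=> b u v; rewrite !fctE lf lg !scalerDr !scalerA (mulrC a).
  by rewrite !addrA; congr (_ + _); rewrite addrAC.
by move=> x; apply: cvgD; [apply: cvgZ; [exact: cvg_cst|exact: cf]|exact: cg].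
Qed.

HB.instance Definition _ :=
  GRing.isSubmodClosed.Build R (X -> R^o) dual_pred dual_pred_submod_closed.
HB.instance Definition _ := [SubChoice_isSubLmodule of dual by <:].

Lemma dual_linear (f : dual) : linear f.
Proof. by case: f => f /= /asboolP[]. Qed.

HB.instance Definition _ (f : dual) :=
  GRing.isLinear.Build R X R^o *:%R f (dual_linear f).

Lemma dual_continuous (f : dual) : continuous f.
Proof. by case: f => f /= /asboolP[]. Qed.

Lemma dual_ext (f g : dual) : f =1 g -> f = g.
Proof. by move=> fg; apply: val_inj; apply/funext. Qed.

Lemma dual_addE (f g : dual) x : (f + g) x = f x + g x. Proof. by []. Qed.

Lemma dual_scaleE a (f : dual) x : (a *: f) x = a * f x. Proof. by []. Qed.

Definition dual_norm (f : dual) : R := sup [set `|f x| | x in unit_ball X].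

Lemma dual_norm_has_sup (f : dual) : has_sup [set `|f x| | x in unit_ball X].
Proof.
split; first by exists `|f 0|, 0 => //; rewrite /unit_ball /= normr0.
have /linear_bounded_continuous/bounded_funP/(_ 1)[M fM] := @dual_continuous f.
by exists M => _ [x x1 <-]; exact: fM.
Qed.

Lemma le_dual_norm (f : dual) (x : X) : `|f x| <= dual_norm f * `|x|.
Proof.
have [->|x0] := eqVneq x 0; first by rewrite raddf0 !normr0 mulr0.
rewrite -ler_pdivrMr ?normr_gt0//.
rewrite -[`|x|]normr_id -normfV -normrM mulrC -[_ * f x]/(_ *: f x) -linearZ.
apply: ub_le_sup; first by have [] := dual_norm_has_sup f.
exists (`|x|^-1 *: x) => //.
by rewrite /unit_ball /= normrZ normfV normr_id mulVf// normr_eq0.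
Qed.

Lemma dual_norm_le (f : dual) (M : R) :
  (forall x, unit_ball X x -> `|f x| <= M) -> dual_norm f <= M.
Proof.
move=> fM; apply: ge_sup; first by have [] := dual_norm_has_sup f.
by move=> _ [x x1 <-]; exact: fM.
Qed.

Let norm_le1 (f : dual) x : unit_ball X x -> `|f x| <= dual_norm f.
Proof.
move=> x1; apply: ub_le_sup; first by have [] := dual_norm_has_sup f.
by exists x.
Qed.

Let norm_ge0 (f : dual) : 0 <= dual_norm f.
Proof.
by apply: le_trans (norm_le1 f (x := 0) _); rewrite /unit_ball /= ?normr0.
Qed.

Let normD (f g : dual) : dual_norm (f + g) <= dual_norm f + dual_norm g.
Proof.
apply: dual_norm_le => x x1; rewrite dual_addE (le_trans (ler_normD _ _))//.
by rewrite lerD// norm_le1.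
Qed.

Let normZ_le (a : R) (f : dual) : dual_norm (a *: f) <= `|a| * dual_norm f.
Proof.
by apply: dual_norm_le => x x1; rewrite dual_scaleE normrM ler_wpM2l// norm_le1.
Qed.

Let normZ (a : R) (f : dual) : dual_norm (a *: f) = `|a| * dual_norm f.
Proof.
have [->|a0] := eqVneq a 0.
  rewrite scale0r normr0 mul0r; apply/le_anti; rewrite norm_ge0 andbT.
  by apply: dual_norm_le => x _; rewrite /= normr0.
apply/le_anti; rewrite normZ_le/= -ler_pdivlMl ?normr_gt0//.
by rewrite -[in leLHS](scalerK a0 f) -normfV normZ_le.
Qed.

Let norm0_eq0 (f : dual) : dual_norm f = 0 -> f = 0.
Proof.
move=> f0; apply: dual_ext => x; apply/normr0_eq0/le_anti.
by rewrite normr_ge0 andbT (le_trans (le_dual_norm f x))// f0 mul0r.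
Qed.

HB.instance Definition _ :=
  Lmodule_isNormed.Build R dual normD normZ norm0_eq0.

Lemma dual_normE (f : dual) : `|f| = sup [set `|f x| | x in unit_ball X].
Proof. by []. Qed.

End dual_space.

Section canonical_embedding.
Context {R : realType} (X : normedModType R).

Lemma eval_dual_pred (x : X) :
  dual_pred (fun f : dual X => (f : X -> R^o) x).
Proof.
apply/asboolP.
have lev : linear (fun f : dual X => (f : X -> R^o) x) by [].
split => //.
pose ev : {linear dual X -> R^o} :=
  HB.pack (fun f : dual X => (f : X -> R^o) x) (GRing.isLinear.Build _ _ _ _ _ lev).
apply: (@bounded_linear_continuous R (dual X) R^o ev); apply/bounded_funP => r.
exists (r * `|x|) => f fr.
by rewrite (le_trans (le_dual_norm f x))// ler_wpM2r.
Qed.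

Definition bidual_emb (x : X) : dual (dual X) := Dual (eval_dual_pred x).

Lemma bidual_embE (x : X) (f : dual X) : bidual_emb x f = f x. Proof. by []. Qed.

End canonical_embedding.

Section linear_subspaces.
Context {R : realType} (V : normedModType R).

Definition closed_subspace (F : set V) :=
  submod_closed [in F] /\ closed F.

Definition closed_span (A : set V) : set V := smallest closed_subspace A.

End linear_subspaces.

Section nicely_smooth.
Context {R : realType} (X : normedModType R).

(* The supremum is taken in the extended reals, so that the empty set is never
   norming. *)
Definition norming_set (A : set (dual X)) :=
  A `<=` unit_ball (dual X) /\
  forall x : X, (`|x|)%:E = ereal_sup [set (f x)%:E | f in A].

Definition norming_subspace (F : set (dual X)) :=
  closed_subspace F /\ norming_set (F `&` unit_ball (dual X)).

Definition nicely_smooth :=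
  forall F : set (dual X), norming_subspace F -> F = setT.

End nicely_smooth.

Section ball_generated.
Context {R : realType} (X : normedModType R).

(* [closed_ball c r] is empty when [r <= 0], hence the positivity condition. *)
Definition finite_union_of_balls (C : set X) :=
  exists s : seq (X * R), (forall p, p \in s -> 0 < p.2) /\
    C = \bigcup_(p in [set` s]) closed_ball p.1 p.2.

Definition ball_generated (C : set X) :=
  exists F : set (set X), F `<=` finite_union_of_balls /\
    C = \bigcap_(D in F) D.

Definition BGP :=
  forall C : set X, closed C -> bounded_set C -> convex_set C ->
    ball_generated C.

End ball_generated.

Definition diam (R : realType) (V : normedModType R) (S : set V) : \bar R :=
  ereal_sup [set (`|p.1 - p.2|)%:E | p in S `*` S].

Section distinguished_points.
Context {R : realType} (X : normedModType R).
Implicit Types (K S : set (dual X)) (f : dual X).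

Definition wstar_slice K S :=
  S !=set0 /\ exists (x : X) (alpha : R), S = [set f | K f /\ alpha < f x].

Definition wstar_denting K f :=
  K f /\ forall eps : R, 0 < eps ->
    exists S, [/\ wstar_slice K S, S f & (diam S < eps%:E)%E].

(* The set [\sum_i l i *: S i] of all sums with one term from each [l i *: S i]. *)
Definition convex_comb_set n (l : 'I_n -> R) (S : 'I_n -> set (dual X)) :
    set (dual X) :=
  [set \sum_i l i *: g i | g in [set g : 'I_n -> dual X | forall i, S i (g i)]].

Definition wstar_SCS K f :=
  K f /\ forall eps : R, 0 < eps ->
    exists n (l : 'I_n -> R) (S : 'I_n -> set (dual X)),
      [/\ forall i, wstar_slice K (S i),
          (forall i, 0 <= l i) /\ \sum_i l i = 1,
          convex_comb_set l S f &
          (diam (convex_comb_set l S) < eps%:E)%E].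

Definition wstar_strongly_exposed K f :=
  K f /\ exists x : X, (f x)%:E = ereal_sup [set (g x)%:E | g in K] /\
    forall g : nat -> dual X, (forall n, K (g n)) ->
      g n x @[n --> \oo] --> f x -> `|g n - f| @[n --> \oo] --> (0 : R).

End distinguished_points.

Section weak_topologies.
Context {R : realType} (X : normedModType R).

(* [{ptws _ -> _}] carries the topology of pointwise convergence, so the two
   initial topologies below are the weakest ones making, respectively, all
   evaluations at points of [X] and all elements of the bidual continuous. *)
Definition wstar_eval (f : dual X) : {ptws X -> R^o} := fun x => f x.

Definition wstar_dual := initial_topology wstar_eval.
HB.instance Definition _ := Topological.on wstar_dual.

Definition weak_eval (f : dual X) : {ptws dual (dual X) -> R^o} :=
  fun phi => phi f.

Definition weak_dual := initial_topology weak_eval.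
HB.instance Definition _ := Topological.on weak_dual.

(* Continuity at [f] of the identity of the unit ball, from the relative weak*
   topology to the weak topology. *)
Definition wstar_weak_PC (f : dual X) :=
  unit_ball (dual X) f /\
  (id : wstar_dual -> weak_dual) @
    within (unit_ball (dual X)) (nbhs (f : wstar_dual)) --> (f : weak_dual).

End weak_topologies.

Section separation.
Context {R : realType} (X : normedModType R).

Definition separated_by_balls :=
  forall F G : dual (dual X), F <> G ->
    exists (x y : X) (r s : R),
      [/\ 0 < r /\ 0 < s,
          closed_ball (bidual_emb x) r F,
          closed_ball (bidual_emb y) s G &
          closed_ball (bidual_emb x) r `&` closed_ball (bidual_emb y) s = set0].

Definition duality_set (x : X) : set (dual X) :=
  [set f | unit_sphere (dual X) f /\ f x = 1].

(* Only the values on the unit sphere matter; outside it [phi] is arbitrary. *)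
Definition support_mapping (phi : X -> dual X) :=
  forall x, unit_sphere X x -> duality_set x (phi x).

Definition separates_bidual (A : set (dual X)) :=
  forall F G : dual (dual X), F <> G -> exists2 f, A f & F f <> G f.

Definition dense_in_sphere (A : set X) :=
  A `<=` unit_sphere X /\ unit_sphere X `<=` closure A.

End separation.

Section asplund.
Context {R : realType} (X : normedModType R).

(* Every continuous convex function on a nonempty open convex set is Frechet
   differentiable ([differentiable]) on a dense G_delta subset of that set; only
   the values of [f] on [U] matter. *)
Definition asplund :=
  forall (U : set X) (f : X -> R^o),
    open U -> U !=set0 -> convex_set U ->
    {within U, continuous f} -> convex_function U f ->
    exists G : set X, [/\ Gdelta G, G `<=` U, U `<=` closure G &
      forall x, G x -> differentiable f x].

Definition separable := exists A : set X, countable A /\ dense A.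

End asplund.

Arguments wstar_weak_PC {R} X f.
Arguments nicely_smooth {R} X.
Arguments BGP {R} X.
Arguments separated_by_balls {R} X.
Arguments asplund {R} X.
Arguments separable {R} X.

(* Main.v *)
From HB Require Import structures.
Require Import Defs.
From mathcomp Require Import all_boot all_order all_algebra.
From mathcomp Require Import all_classical all_reals all_analysis.
From mathcomp Require Import ring lra.

Set Implicit Arguments.
Unset Strict Implicit.
Unset Printing Implicit Defensive.

Import Order.TTheory GRing.Theory Num.Def Num.Theory.
Import numFieldNormedType.Exports.

Local Open Scope classical_set_scope.
Local Open Scope ring_scope.

(** The five conditions of the first group and the four of the second are linked
through two cycles of implications.

For an arbitrary Banach space, strongly exposed points are denting, denting
points are SCS points ([strongly_exposed_denting], [denting_SCS]), and SCS
points are continuous on bounded sets for the ball topology, the coarsest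
topology in which closed balls are closed ([SCS_ball_continuous]). The
functionals with that continuity form a closed subspace, and if all functionals
have it, then Hahn-Banach separation proves that closed bounded convex sets are
ball-generated ([ball_continuous_BGP]). A proper norming subspace is
annihilated by a nonzero element of the bidual, and Goldstine's theorem moves
this element back into the space, where it contradicts the ball generated
property ([BGP_nicely_smooth]).

In the second group, Helly's theorem on finite systems of functionals shows
that a weak*-weak point of continuity [f] separates an element [G] of the
bidual from a hyperplane by a ball centred in the space ([PC_half_space]).
Hence if such points span the dual, points of the bidual are separated by
balls, and an annihilator of a norming subspace cannot be separated from the
origin. The support functionals along a dense subset of the sphere span a
norming subspace ([support_norming]), which is the whole dual if the space is
nicely smooth.

The implications that close both cycles use the Asplund or separability
hypothesis, in the same way: they provide a dense set of points where the norm
is Frechet smooth, and there every support functional is strongly exposed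
([smooth_point_strongly_exposed]). Support functionals at the normalizations of
these points separate the bidual, so strongly exposed points span the dual;
they are moreover points of continuity ([strongly_exposed_PC]). For an Asplund
space smooth points are dense by definition. For a separable space the support
functionals along a countable dense subset of the sphere already span the dual,
which is therefore separable, and a Baire category argument applies
([separable_dual_smooth_dense]).

All tools of functional analysis are derived from one form of the Hahn-Banach
theorem, [hahn_banach_separation]. *)

(** * Hahn-Banach theorem *)

Section hahn_banach.
Context {R : realType} {V : lmodType R}.
Implicit Types (p q : V -> R) (K : set V).

Lemma convex_setP K : convex_set K <->
  forall x y (t : R), K x -> K y -> 0 <= t -> t <= 1 ->
    K (t *: x + (1 - t) *: y).
Proof.
split=> [cK x y t Kx Ky t0 t1|cK x y t].
  have t01 : (0 <= t <= 1)%R by rewrite t0 t1.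
  by have := cK x y (@Itv01 R t t0 t1); rewrite !inE; apply.
rewrite !inE => Kx Ky; apply: cK => //.
Qed.

Definition sublinear p := (forall x y, p (x + y) <= p x + p y) /\
  forall (t : R) x, 0 < t -> p (t *: x) <= t * p x.

Lemma sublinear0 p : sublinear p -> p 0 = 0.
Proof.
move=> [_ pZ]; apply/le_anti/andP; split.
  by have := pZ (2^-1) 0; rewrite scaler0 invr_gt0 ltr0n => /(_ isT); lra.
by have := pZ 2 0; rewrite scaler0 ltr0n => /(_ isT); lra.
Qed.

Lemma sublinearZ p (t : R) x : sublinear p -> 0 <= t -> p (t *: x) = t * p x.
Proof.
move=> sp; rewrite le_eqVlt => /predU1P[<-|t0].
  by rewrite scale0r mul0r sublinear0.
apply/le_anti; rewrite sp.2//= -ler_pdivlMl//.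
by rewrite -[in leLHS](scalerK (lt0r_neq0 t0) x) sp.2// invr_gt0.
Qed.

(** The functional [x |-> inf {p (x + t y) - t d | 0 <= t, y in K}] is still
sublinear because [K] is convex, and any linear functional below it is at least
[d] on [K]. This turns a separation problem into a domination problem. *)
Lemma sandwich_sublinear p K (d : R) : sublinear p -> K !=set0 ->
  convex_set K -> (forall y, K y -> d <= p y) ->
  exists q, [/\ sublinear q, forall x, q x <= p x &
    forall y, K y -> q (- y) <= - d].
Proof.
move=> sp [y0 Ky0] /convex_setP cK dp.
pose S x := [set r | exists (t : R) y, [/\ 0 <= t, K y &
  r = p (x + t *: y) - t * d]].
have S0 x : S x !=set0 by exists (p (x + 0 *: y0) - 0 * d), 0, y0.
have lbS x : lbound (S x) (- p (- x)).
  move=> _ [t [y [t0 Ky ->]]].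
  have := sp.1 (x + t *: y) (- x); rewrite addrAC subrr add0r sublinearZ//.
  by have := ler_wpM2l t0 (dp _ Ky); lra.
have infle x r : S x r -> inf (S x) <= r.
  by move=> Sr; apply: ge_inf => //; exists (- p (- x)); exact: lbS.
exists (fun x => inf (S x)); split; first split.
- move=> x y; rewrite -lerBlDr; apply: lb_le_inf => // _ [t [u [t0 Ku ->]]].
  rewrite lerBlDr -lerBlDl; apply: lb_le_inf => // _ [s [v [s0 Kv ->]]].
  rewrite lerBlDl.
  have [w Kw tsw] : exists2 w, K w & (t + s) *: w = t *: u + s *: v.
    have [ts0|ts0] := eqVneq (t + s) 0.
      exists u => //; have [-> ->] : t = 0 /\ s = 0 by split; lra.
      by rewrite addr0 !scale0r addr0.
    have tsgt : 0 < t + s by rewrite lt0r ts0 addr_ge0.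
    exists ((t / (t + s)) *: u + (1 - t / (t + s)) *: v).
      by apply: cK => //; rewrite ?divr_ge0 ?addr_ge0// ler_pdivrMr//; lra.
    rewrite scalerDr !scalerA; congr (_ *: _ + _ *: _); first by field.
    by field.
  apply: (@le_trans _ _ (p (x + y + (t + s) *: w) - (t + s) * d)).
    by apply: infle; exists (t + s), w; rewrite addr_ge0.
  rewrite tsw addrACA; have := sp.1 (x + t *: u) (y + s *: v); lra.
- move=> t x t0; rewrite -ler_pdivrMl//.
  apply: lb_le_inf => // _ [s [u [s0 Ku ->]]]; rewrite ler_pdivrMl//.
  apply: infle; exists (t * s), u; split => //; first by rewrite mulr_ge0// ltW.
  by rewrite -scalerA -scalerDr sublinearZ// ?ltW//; ring.
- move=> x; apply: infle; exists 0, y0; split => //.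
  by rewrite scale0r addr0 mul0r subr0.
- move=> y Ky; apply: infle; exists 1, y; split => //.
  by rewrite scale1r addNr sublinear0// mul1r add0r.
Qed.

(** Zorn's lemma: the pointwise infimum of a chain of sublinear functionals
below [p] is finite, since [q x] is at least [- p (- x)] for each of them, and
is again sublinear. *)
Lemma minimal_sublinear p : sublinear p ->
  exists q, [/\ sublinear q, forall x, q x <= p x &
    forall r, sublinear r -> (forall x, r x <= q x) -> r = q].
Proof.
move=> sp.
pose T := {q : V -> R | sublinear q /\ forall x, q x <= p x}.
pose le (q r : T) := `[< forall x, sval r x <= sval q x >].
have [||||[q [sq qp]] qmin] := @Zorn T le.
- by move=> t; apply/asboolP.
- move=> r s t /asboolP rs /asboolP st; apply/asboolP => x.
  exact: le_trans (rs x).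
- move=> [s hs] [t ht] /asboolP/= st /asboolP/= ts.
  have est : s = t by apply/funext => x; apply/le_anti; rewrite st ts.
  by case: _ / est ht st ts => ht _ _; congr exist; exact: Prop_irrelevance.
- move=> A totA; have [A0|/set0P[q0 Aq0]] := eqVneq A set0.
    have pp : sublinear p /\ forall x, p x <= p x by [].
    by exists (exist _ p pp) => s; rewrite A0.
  pose S x := [set sval q x | q in A].
  have S0 x : S x !=set0 by exists (sval q0 x), q0.
  have lbS x : lbound (S x) (- p (- x)).
    move=> _ [[q [sq qp]] Aq <-] /=; have := sq.1 x (- x).
    by rewrite subrr sublinear0//; have := qp (- x); lra.
  have infle x (q : T) : A q -> inf (S x) <= sval q x.
    by move=> Aq; apply: ge_inf; [exists (- p (- x)); exact: lbS|exists q].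
  have sm : sublinear (fun x => inf (S x)).
    split=> [x y|t x t0].
      rewrite -lerBlDr; apply: lb_le_inf => // _ [q Aq <-].
      rewrite lerBlDr -lerBlDl; apply: lb_le_inf => // _ [r Ar <-].
      rewrite lerBlDl; have [/asboolP qr|/asboolP rq] := totA _ _ Aq Ar.
        rewrite (le_trans (infle _ _ Ar))// (le_trans ((svalP r).1.1 _ _))//.
        by rewrite lerD2r.
      rewrite (le_trans (infle _ _ Aq))// (le_trans ((svalP q).1.1 _ _))//.
      by rewrite lerD2l.
    rewrite -ler_pdivrMl//; apply: lb_le_inf => // _ [q Aq <-].
    by rewrite ler_pdivrMl// (le_trans (infle _ _ Aq))// (svalP q).1.2.
  have mp x : inf (S x) <= p x.
    by rewrite (le_trans (infle _ _ Aq0))// (svalP q0).2.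
  exists (exist _ (fun x => inf (S x)) (conj sm mp) : T) => s As.
  by apply/asboolP => x; exact: infle.
exists q; split => // r sr rq.
have rp x : r x <= p x := le_trans (rq x) (qp x).
suff /(congr1 sval) :
  (exist _ r (conj sr rp) : T) = exist _ q (conj sq qp) by [].
by apply: qmin; apply/asboolP.
Qed.

(** A minimal sublinear functional [q] is linear: applying
[sandwich_sublinear] to a singleton [[set x]] gives a smaller functional, hence
[q] itself, so that [q (- x) <= - q x]. *)
Lemma hahn_banach_separation p K (d : R) : sublinear p -> K !=set0 ->
  convex_set K -> (forall y, K y -> d <= p y) ->
  exists f : {linear V -> R^o},
    (forall x, f x <= p x) /\ forall y, K y -> d <= f y.
Proof.
move=> sp K0 cK dp.
have [p' [sp' p'p p'K]] := sandwich_sublinear sp K0 cK dp.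
have [q [sq qp' qmin]] := minimal_sublinear sp'.
have qN x : q (- x) = - q x.
  apply/le_anti/andP; split; last first.
    by have := sq.1 x (- x); rewrite subrr sublinear0//; lra.
  have cx : convex_set [set x].
    apply/convex_setP => _ _ t -> -> _ _ /=.
    by rewrite -scalerDl addrC subrK scale1r.
  have [||r [sr rq]] := @sandwich_sublinear q [set x] (q x) sq _ cx.
  - by exists x.
  - by move=> _ ->.
  by rewrite (qmin r sr rq) => /(_ x erefl).
have qD x y : q (x + y) = q x + q y.
  apply/le_anti; rewrite sq.1 /=.
  by have := sq.1 (x + y) (- y); rewrite addrK qN; lra.
have lq : linear (q : V -> R^o).
  move=> a x y; rewrite qD; congr (_ + _).
  have [a0|/ltW a0] := leP 0 a; first by rewrite sublinearZ.
  by rewrite -[a]opprK scaleNr qN sublinearZ ?oppr_ge0// scaleNr.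
pose f : {linear V -> R^o} :=
  HB.pack (q : V -> R^o) (GRing.isLinear.Build _ _ _ _ _ lq).
exists f; split=> /=.
- by move=> x; rewrite (le_trans (qp' x)).
- by move=> y Ky; have := le_trans (qp' _) (p'K _ Ky); rewrite qN lerN2.
Qed.

End hahn_banach.

(** * Functionals on normed spaces, Helly's and Goldstine's theorems *)

Section dual_functionals.
Context {R : realType}.
Implicit Types X V : normedModType R.

Lemma dualZ X (f : dual X) a x : f (a *: x) = a * f x.
Proof. exact: linearZ. Qed.

Lemma ler_dual X (f : dual X) x : `|f x| <= `|f| * `|x|.
Proof. exact: le_dual_norm. Qed.

Lemma dual_norm_le1P X (f : dual X) :
  `|f| <= 1 <-> forall x, f x <= `|x|.
Proof.
split=> [f1 x|fx].
  rewrite (le_trans (ler_norm _))// (le_trans (ler_dual f x))//.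
  by rewrite ler_piMl.
apply: dual_norm_le => x x1; rewrite ler_norml lerNl -linearN.
by rewrite !(le_trans (fx _))// normrN.
Qed.

Lemma dual_le X (f : dual X) x : `|f| <= 1 -> f x <= `|x|.
Proof. by move=> /dual_norm_le1P. Qed.

Lemma dual_ge X (f : dual X) x : `|f| <= 1 -> - `|x| <= f x.
Proof. by move=> f1; rewrite lerNl -linearN -normrN dual_le. Qed.

Lemma dual_of_linear X (f : {linear X -> R^o}) : (forall x, f x <= `|x|) ->
  exists2 g : dual X, `|g| <= 1 & forall x, g x = f x.
Proof.
move=> fx; have fp : dual_pred (f : X -> R^o).
  apply/asboolP; split; first exact: linearP.
  apply: bounded_linear_continuous; apply/bounded_funP => r.
  exists r => x; apply: le_trans; rewrite ler_norml lerNl -linearN.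
  by rewrite !(le_trans (fx _))// normrN.
by exists (Dual fp) => //; apply/dual_norm_le1P.
Qed.

Lemma norm_sublinear X : sublinear (fun x : X => `|x|).
Proof.
split=> [x y|t x t0]; first exact: ler_normD.
by rewrite normrZ gtr0_norm.
Qed.

Lemma norm_separation X (K : set X) (d : R) : K !=set0 -> convex_set K ->
  (forall y, K y -> d <= `|y|) ->
  exists2 f : dual X, `|f| <= 1 & forall y, K y -> d <= f y.
Proof.
move=> K0 cK /(hahn_banach_separation (norm_sublinear X) K0 cK)[f [fx fK]].
have [g g1 gf] := dual_of_linear fx.
by exists g => // y Ky; rewrite gf fK.
Qed.

Lemma norm_attaining_functional X (x : X) :
  exists2 f : dual X, `|f| <= 1 & f x = `|x|.
Proof.
have [|||f f1 fx] := @norm_separation X [set x] `|x|.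
- by exists x.
- apply/convex_setP => _ _ t -> -> _ _ /=.
  by rewrite -scalerDl addrC subrK scale1r.
- by move=> _ ->.
by exists f => //; apply/le_anti; rewrite fx// andbT dual_le.
Qed.

Lemma closed_subspaceP X (F : set X) : closed_subspace F <->
  [/\ F 0, forall a u v, F u -> F v -> F (a *: u + v) & closed F].
Proof.
rewrite /closed_subspace /submod_closed; split=> [[[F0 FL] cF]|[F0 FL cF]].
  split => //; first by rewrite inE in F0.
  by move=> a u v Fu Fv; have := FL a u v; rewrite !inE; apply.
split=> //; split; first by rewrite inE.
by move=> a u v; rewrite !inE; exact: FL.
Qed.

(** Separate [0] from the translate [x0 - F] of the subspace by some [d > 0]:
a linear functional bounded below on a line in the direction [y] vanishes at
[y]. *)
Lemma annihilating_functional X (F : set X) : closed_subspace F ->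
  F <> setT -> exists2 f : dual X, f <> 0 & forall y, F y -> f y = 0.
Proof.
move=> /closed_subspaceP[F0 FL cF] FT.
have [x0 Fx0] : exists x0, ~ F x0.
  by apply/existsNP => allF; apply: FT; apply/seteqP; split.
have /nbhs_ballP[d /= d0 dF] : nbhs x0 (~` F).
  by apply: open_nbhs_nbhs; split => //; exact: closed_openC.
have Fd y : F y -> d <= `|x0 - y|.
  move=> Fy; rewrite leNgt; apply/negP => xyd.
  by apply: (dF y) => //; rewrite -ball_normE.
have [|||f f1 fF] := @norm_separation X [set x0 - y | y in F] d.
- by exists (x0 - 0), 0.
- apply/convex_setP => _ _ t [u Fu <-] [v Fv <-] _ _.
  exists (t *: u + ((1 - t) *: v + 0)); first by do 2 apply: (FL) => //.
  rewrite addr0 !scalerBr addrACA -scalerDl (addrC t) subrK scale1r.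
  by rewrite opprD.
- by move=> _ [y Fy <-]; exact: Fd.
have fx0 : d <= f x0 by rewrite -[x0]subr0 fF//; exists 0.
exists f; first by move=> f0; move: fx0; rewrite f0 leNgt d0.
move=> y Fy; apply/eqP; apply/contraT => fy0.
have : d <= f (x0 - ((f x0 / f y) *: y + 0)).
  by apply: fF; eexists => //; exact: FL.
rewrite addr0 linearB linearZ/= -[_ *: _]/(_ * _) divfK// subrr.
by rewrite leNgt d0.
Qed.

Lemma closed_span_closed_subspace X (A : set X) :
  closed_subspace (closed_span A).
Proof.
apply/closed_subspaceP; split.
- by move=> F /= [/closed_subspaceP[]].
- move=> a u v Au Av F /= FA; have [/closed_subspaceP[_ FL _] _] := FA.
  by apply: FL; [exact: Au|exact: Av].
- apply: closed_bigI => F /= [/closed_subspaceP[]] //.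
Qed.

Lemma sub_closed_span X (A : set X) : A `<=` closed_span A.
Proof. exact: sub_gen_smallest. Qed.

Lemma closed_span_sub X (A F : set X) : closed_subspace F -> A `<=` F ->
  closed_span A `<=` F.
Proof. exact: smallest_sub. Qed.

Lemma closed_span_setTS X (A B : set X) : A `<=` B ->
  closed_span A = setT -> closed_span B = setT.
Proof.
move=> AB AT; apply/seteqP; split => //; rewrite -AT.
apply: closed_span_sub; first exact: closed_span_closed_subspace.
exact: subset_trans (@sub_closed_span _ _).
Qed.

Lemma kernel_closed_subspace X (f : dual X) : closed_subspace [set x | f x = 0].
Proof.
apply/closed_subspaceP; split.
- exact: linear0.
- by move=> a u v /= u0 v0; rewrite linearP/= u0 v0 addr0 scaler0.
- by apply: (@closed_comp _ _ f [set 0]) => // x _; exact: dual_continuous.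
Qed.

Lemma closed_span_eq X (A : set X) (f g : dual X) : closed_span A = setT ->
  (forall x, A x -> f x = g x) -> f = g.
Proof.
move=> AT fg; apply/eqP; rewrite -subr_eq0; apply/eqP/dual_ext => x.
suff : [set x | (f - g) x = 0] x by [].
apply: (closed_span_sub (kernel_closed_subspace (f - g)) _ (A := A)).
  by move=> y Ay /=; apply/eqP; rewrite subr_eq0; apply/eqP; exact: fg.
by rewrite AT.
Qed.

(** Otherwise, in the space of [n]-tuples with the [l^1] norm, the convex set of
all [(phi i v - c i)_i] with [`|v| <= M] stays at distance [eps] from the
origin. The coefficients of a functional that separates them, up to sign,
contradict the hypothesis. *)
Lemma helly V n (phi : 'I_n -> dual V) (c : 'I_n -> R) (M eps : R) :
  0 <= M -> 0 < eps ->
  (forall a : 'I_n -> R, \sum_i a i * c i <= M * `|\sum_i a i *: phi i|) ->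
  exists2 v, `|v| <= M & forall i, `|phi i v - c i| < eps.
Proof.
move=> M0 eps0 H.
pose u (x : V) : 'rV[R]_n := \row_i (phi i (M *: x) - c i).
pose p (w : 'rV[R]_n) := \sum_i `|w 0 i|.
suff [x x1 pu] : exists2 x : V, `|x| <= 1 & p (u x) < eps.
  exists (M *: x) => [|i]; first by rewrite normrZ ger0_norm// ler_piMr.
  apply: le_lt_trans pu; rewrite /p (bigD1 i)//= /u mxE.
  by rewrite lerDl sumr_ge0.
apply: contrapT => nE.
have [||||f [_ fK]] := @hahn_banach_separation R _ p (u @` unit_ball V) eps.
- split=> [x y|t x t0]; rewrite /p.
    by rewrite -big_split ler_sum//= => i _; rewrite mxE ler_normD.
  by rewrite mulr_sumr ler_sum// => i _; rewrite mxE normrM gtr0_norm.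
- by exists (u 0), 0 => //; rewrite /unit_ball/= normr0.
- apply/convex_setP => _ _ t [x x1 <-] [y y1 <-] t0 t1.
  exists (t *: x + (1 - t) *: y).
    rewrite /unit_ball/= (le_trans (ler_normD _ _))// !normrZ.
    rewrite !ger0_norm ?subr_ge0// -[leRHS](subrK t) addrC.
    by rewrite lerD// ler_piMr// subr_ge0.
  by apply/rowP => i; rewrite !mxE !dualZ linearD/= !dualZ; ring.
- move=> _ [x x1 <-]; rewrite leNgt; apply/negP => xe.
  by apply: nE; exists x.
pose b i := - f (delta_mx 0 i).
have fu x : f (u x) = \sum_i b i * c i - M * (\sum_i b i *: phi i : dual V) x.
  rewrite [u x]row_sum_delta linear_sum.
  have -> : (\sum_i b i *: phi i : dual V) x = \sum_i b i * phi i x.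
    by rewrite -[LHS]/(bidual_emb x _) linear_sum.
  rewrite mulr_sumr -sumrB; apply: eq_bigr => i _.
  by rewrite linearZ/= /u mxE dualZ -[_ *: _]/(_ * _) /b; ring.
have : M * `|\sum_i b i *: phi i| <= \sum_i b i * c i - eps.
  rewrite -[M in leLHS]ger0_norm// -normrZ; apply: dual_norm_le => x x1.
  rewrite dual_scaleE ler_norml.
  have := fK _ (ex_intro2 _ _ x x1 erefl).
  have xN1 : unit_ball V (- x) by rewrite /unit_ball/= normrN.
  have := fK _ (ex_intro2 _ _ _ xN1 erefl).
  by rewrite !fu linearN; lra.
by have := H b; lra.
Qed.

(** The bidual element supplies the compatibility condition of [helly]. *)
Lemma goldstine V n (phi : 'I_n -> dual V) (F : dual (dual V)) (eps : R) :
  0 < eps ->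
  exists2 v, `|v| <= `|F| & forall i, `|phi i v - F (phi i)| < eps.
Proof.
move=> eps0; apply: helly => // a.
have -> : \sum_i a i * F (phi i) = F (\sum_i a i *: phi i).
  by rewrite linear_sum; apply: eq_bigr => i _; rewrite linearZ.
exact: le_trans (ler_norm _) (ler_dual _ _).
Qed.

End dual_functionals.

(** * Exposed, denting and SCS points, and the ball generated property *)

Section points.
Context {R : realType} (X : normedModType R).
Implicit Types (f g : dual X) (S : set (dual X)).

Lemma diam_lt (V : normedModType R) (A : set V) (e : R) u v :
  (diam A < e%:E)%E -> A u -> A v -> `|u - v| < e.
Proof.
move=> Ae Au Av; rewrite -lte_fin; apply: le_lt_trans Ae.
by apply: ereal_sup_ubound; exists (u, v).
Qed.

Lemma diam_le (V : normedModType R) (A : set V) (e : R) :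
  (forall u v, A u -> A v -> `|u - v| <= e) -> (diam A <= e%:E)%E.
Proof.
move=> Ae; apply: ge_ereal_sup => _ [[u v] [/= Au Av] <-].
by rewrite lee_fin Ae.
Qed.

Lemma ereal_sup_unit_ball (x : X) :
  ereal_sup [set (g x)%:E | g in unit_ball (dual X)] = (`|x|)%:E.
Proof.
apply/le_anti/andP; split.
  by apply: ge_ereal_sup => _ [g g1 <-]; rewrite lee_fin dual_le.
have [f f1 <-] := norm_attaining_functional x.
by apply: ereal_sup_ubound; exists f.
Qed.

(** The slices defined by an exposing vector have diameters tending to [0]:
otherwise a sequence chosen in slices shrinking to the supporting hyperplane
would not converge to [f]. *)
Lemma strongly_exposedP f :
  wstar_strongly_exposed (unit_ball (dual X)) f <->
  `|f| <= 1 /\ exists x, f x = `|x| /\ forall eps, 0 < eps ->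
    exists2 delta, 0 < delta & forall g, `|g| <= 1 -> `|x| - delta < g x ->
      `|g - f| < eps.
Proof.
split=> -[f1 [x [fx H]]]; split => //; exists x; split.
- by apply/EFin_inj; rewrite fx ereal_sup_unit_ball.
- move=> eps eps0; apply: contrapT => nH.
  have {}fx : f x = `|x| by apply/EFin_inj; rewrite fx ereal_sup_unit_ball.
  have /choice[g gP] (n : nat) : exists g,
      [/\ `|g| <= 1, `|x| - n.+1%:R^-1 < g x & eps <= `|g - f|].
    apply: contrapT => ng; apply: nH; exists n.+1%:R^-1 => // g g1 gx.
    by rewrite ltNge; apply/negP => ge; apply: ng; exists g.
  have /cvgrPdist_lt/(_ _ eps0)[N _ /(_ N (leqnn N))/=] :
      `|g n - f| @[n --> \oo] --> (0 : R).
    apply: H => [n|]; first by have [] := gP n.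
    rewrite fx.
    apply: (@squeeze_cvgr _ _ _ _ (fun n => `|x| - n.+1%:R^-1) (cst `|x|)).
    + by apply: nearW => n; have [gn1 /ltW-> _] := gP n; rewrite dual_le.
    + rewrite -[X in _ --> X]subr0; apply: cvgB; first exact: cvg_cst.
      exact: cvg_harmonic.
    + exact: cvg_cst.
  by have [_ _] := gP N; rewrite sub0r normrN normr_id leNgt => /negP.
- by rewrite ereal_sup_unit_ball fx.
- move=> g g1; rewrite fx => /cvgrPdist_lt gx.
  apply/cvgrPdist_lt => e /H[d /gx gd dH].
  near=> n; rewrite sub0r normrN normr_id dH//; first exact: g1.
  have : `| `|x| - g n x | < d by near: n.
  by rewrite ltr_norml => /andP[_]; lra.
Unshelve. all: by end_near. Qed.

Lemma strongly_exposed_denting f :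
  wstar_strongly_exposed (unit_ball (dual X)) f ->
  wstar_denting (unit_ball (dual X)) f.
Proof.
move=> /strongly_exposedP[f1 [x [fx H]]]; split => // eps eps0.
have [|d d0 dH] := H (eps / 3); first by rewrite divr_gt0.
pose S := [set g | unit_ball (dual X) g /\ `|x| - d < g x].
have Sf : S f by split => //; rewrite fx; lra.
exists S; split => //; first by split; [exists f|exists x, (`|x| - d)].
apply: (@le_lt_trans _ _ (eps / 3 + eps / 3)%:E); last by rewrite lte_fin; lra.
apply: diam_le => g h [g1 gx] [h1 hx].
rewrite -[g - h](subrKA f); apply: le_trans (ler_normD _ _) _.
rewrite (distrC f h).
exact: lerD (ltW (dH _ g1 gx)) (ltW (dH _ h1 hx)).
Qed.

Lemma denting_SCS f :
  wstar_denting (unit_ball (dual X)) f -> wstar_SCS (unit_ball (dual X)) f.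
Proof.
move=> [f1 fd]; split => // eps /fd[S [Ssl Sf dS]].
have combS : convex_comb_set (fun=> 1 : R) (fun _ : 'I_1 => S) = S.
  apply/seteqP; split=> [_ [g Sg <-]|g Sg].
    by rewrite big_ord1 scale1r.
  by exists (fun=> g) => //; rewrite big_ord1 scale1r.
exists 1%N, (fun=> 1), (fun=> S); rewrite combS; split => //.
by split=> [_|]; rewrite ?ler01// big_ord1.
Qed.

(** Neighbourhoods of the origin for the ball topology, the coarsest one in
which all closed balls are closed, relative to the ball of radius [r]: the
condition [0 < p.2 < `|p.1|] says that the origin lies outside the closed ball
with centre [p.1] and radius [p.2]. *)
Definition ball_near0 (r : R) (P : set X) :=
  exists s : seq (X * R), (forall p, p \in s -> 0 < p.2 < `|p.1|) /\
    forall x, `|x| <= r -> (forall p, p \in s -> p.2 < `|x - p.1|) -> P x.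

(** Continuity at the origin, hence everywhere, of the restrictions of [f] to
bounded sets for the ball topology. *)
Definition ball_continuous f := forall r delta : R, 0 < delta ->
  ball_near0 r [set x | `|f x| < delta].

(** If the slice is [{g | alpha < g x0}] with [x0 != 0], take the ball with
centre [- t x0] and radius [t `|x0| - delta], with [t] large. If [x] is outside
that ball, a functional attaining the norm of [x + t x0] must be large at [x0],
and so be in the slice, and cannot be below [- delta] at [x]. *)
Lemma slice_outside_balls S (r delta : R) :
  wstar_slice (unit_ball (dual X)) S -> 0 < delta ->
  ball_near0 r [set x | exists2 g, S g & - delta <= g x].
Proof.
move=> [[g0 Sg0] [x0 [alpha SE]]] d0; rewrite SE in Sg0 *.
have ax0 : alpha < `|x0|.
  by case: Sg0 => g01 /lt_le_trans; apply; exact: dual_le.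
have [x00|x00] := eqVneq x0 0.
  exists [::]; split=> // x _ _; exists 0; last by rewrite /= oppr_le0 ltW.
  by split; [rewrite /unit_ball/= normr0|rewrite x00 normr0 in ax0].
have nx0 : 0 < `|x0| by rewrite normr_gt0.
(* [t] is at least [A], which forces [alpha < g x0], and at least [B], which
   makes the radius positive. *)
have a0 : 0 < `|x0| - alpha by rewrite subr_gt0.
pose A := (delta + `|r|) / (`|x0| - alpha).
pose B := (delta + 1) / `|x0|.
have A0 : 0 <= A by apply: divr_ge0; [apply: addr_ge0 => //|]; exact: ltW.
have B0 : 0 <= B by apply: divr_ge0; [apply: addr_ge0 => //; exact: ltW|].
have AE : A * (`|x0| - alpha) = delta + `|r| by rewrite divfK ?gt_eqF.
have BE : B * `|x0| = delta + 1 by rewrite divfK ?gt_eqF.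
pose t := A + B.
have t1 : delta + `|r| <= t * (`|x0| - alpha).
  by rewrite mulrDl AE lerDl mulr_ge0// ltW.
have t2 : delta < t * `|x0|.
  by rewrite mulrDl BE; have := mulr_ge0 A0 (ltW nx0); lra.
have t0 : 0 < t by rewrite -(pmulr_lgt0 _ nx0); lra.
exists [:: (- (t *: x0), t * `|x0| - delta)]; split.
  by move=> _ /[1!inE]/eqP->/=; rewrite normrN normrZ gtr0_norm//; lra.
move=> x xr /(_ _ (mem_head _ _))/=; rewrite opprK => H.
have [g g1 gx] := norm_attaining_functional (x + t *: x0).
rewrite -gx linearD/= dualZ in H.
have gxr : g x <= `|r|.
  by rewrite (le_trans (dual_le x g1))// (le_trans xr)// ler_norm.
have gx0 : t * g x0 <= t * `|x0| by rewrite ler_wpM2l ?dual_le// ltW.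
exists g; last lra.
by split=> //; rewrite -(ltr_pM2l t0); lra.
Qed.

(** Outside the balls attached to the slices of a small combination, [x] is
almost nonnegative on one member of each slice, hence on a member of the
combination, which is norm-close to [f]. *)
Lemma SCS_outside_balls f (r delta : R) :
  wstar_SCS (unit_ball (dual X)) f -> 0 < delta ->
  ball_near0 r [set x | - delta < f x].
Proof.
move=> [f1 fSCS] d0.
have [|n [l [S [Ssl [l0 l1] [g0 g0S f_sum] dS]]]] :=
    fSCS (delta / 2 / (`|r| + 1)).
  by apply: divr_gt0; [exact: divr_gt0|exact: ltr_wpDl].
have /choice[s sP] : forall i,
    ball_near0 r [set x | exists2 g, S i g & - (delta / 2) <= g x].
  by move=> i; apply: slice_outside_balls => //; rewrite divr_gt0.
exists (flatten [seq s i | i : 'I_n]).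
split=> [p /flatten_mapP[i _]|x xr xs /=].
  by have [+ _] := sP i; apply.
have /choice[g gP] : forall i, exists g, S i g /\ - (delta / 2) <= g x.
  move=> i; have [|g Sg gx] := (sP i).2 x xr; last by exists g.
  by move=> p ps; apply: xs; apply/flatten_mapP; exists i; rewrite ?mem_enum.
have fg : `|f - \sum_i l i *: g i| < delta / 2 / (`|r| + 1).
  apply: (diam_lt dS) => //; first by exists g0.
  by exists g => // i; have [] := gP i.
have gx : - (delta / 2) <= (\sum_i l i *: g i : dual X) x.
  have -> : (\sum_i l i *: g i : dual X) x = \sum_i l i * g i x.
    by rewrite -[LHS]/(bidual_emb x _) linear_sum.
  have -> : - (delta / 2) = \sum_i l i * - (delta / 2).
    by rewrite -mulr_suml l1 mul1r.
  by apply: ler_sum => i _; rewrite ler_wpM2l//; have [] := gP i.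
have : `|(f - \sum_i l i *: g i) x| < delta / 2.
  rewrite (le_lt_trans (ler_dual _ _))//.
  apply: (@le_lt_trans _ _ (`|f - \sum_i l i *: g i| * (`|r| + 1))).
    by rewrite ler_wpM2l// (le_trans xr)// (le_trans (ler_norm _))// lerDl.
  by rewrite -ltr_pdivlMr// ltr_wpDl.
rewrite -[_ x]/(f x - (\sum_i l i *: g i : dual X) x) ltr_norml => /andP[]; lra.
Qed.

Lemma SCS_ball_continuous f :
  wstar_SCS (unit_ball (dual X)) f -> ball_continuous f.
Proof.
move=> fSCS r d d0; have [s [s0 sP]] := SCS_outside_balls r fSCS d0.
(* Adding the opposite balls makes the situation symmetric in [x]. *)
exists (s ++ [seq (- p.1, p.2) | p <- s]); split=> [p|x xr xs /=].
  by rewrite mem_cat => /orP[/s0//|/mapP[q /s0 + ->]]; rewrite /= normrN.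
rewrite ltr_norml sP//=; last by move=> p ps; rewrite xs// mem_cat ps.
rewrite -ltrN2 -linearN sP ?normrN// => p ps.
have : (- p.1, p.2) \in s ++ [seq (- p.1, p.2) | p <- s].
  by rewrite mem_cat (map_f (fun p => (- p.1, p.2)) ps) orbT.
by move=> /xs/=; rewrite -normrN opprB addrC.
Qed.

Lemma ball_continuous_closed_subspace :
  closed_subspace [set f | ball_continuous f].
Proof.
apply/closed_subspaceP; split=> /=.
- by move=> r d d0; exists [::]; split=> // x _ _; rewrite /= normr0.
- move=> a u v cu cv r d d0.
  have a1 : 0 < `|a| + 1 by rewrite ltr_wpDl.
  have [|s [s0 sP]] := cu r (d / 2 / (`|a| + 1)); first by rewrite !divr_gt0.
  have [|t [t0 tP]] := cv r (d / 2); first by rewrite divr_gt0.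
  exists (s ++ t); split=> [p|x xr xs /=].
    by rewrite mem_cat => /orP[/s0|/t0].
  have /(tP _ xr) tx : forall p, p \in t -> p.2 < `|x - p.1|.
    by move=> p pt; rewrite xs// mem_cat pt orbT.
  have /(sP _ xr) sx : forall p, p \in s -> p.2 < `|x - p.1|.
    by move=> p ps; rewrite xs// mem_cat ps.
  suff : `|a * u x + v x| < d by [].
  rewrite (le_lt_trans (ler_normD _ _))// normrM.
  move: tx => /=; suff : `|a| * `|u x| <= d / 2 by lra.
  apply: (@le_trans _ _ ((`|a| + 1) * `|u x|)).
    by rewrite ler_wpM2r// lerDl.
  by rewrite mulrC -ler_pdivlMr// ltW// sx.
- move=> f fcl r d d0.
  have r1 : 0 < `|r| + 1 by rewrite ltr_wpDl.
  have e0 : 0 < d / 2 / (`|r| + 1) by rewrite !divr_gt0.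
  have [g [/= cg]] := fcl _ (nbhsx_ballx f _ e0).
  rewrite -ball_normE/= => fg.
  have [|s [s0 sP]] := cg r (d / 2); first by rewrite divr_gt0.
  exists s; split=> // x xr xs /=.
  have /= := sP x xr xs.
  have : `|(f - g) x| < d / 2.
    rewrite (le_lt_trans (ler_dual _ _))//.
    apply: (@le_lt_trans _ _ (`|f - g| * (`|r| + 1))).
      by rewrite ler_wpM2l// (le_trans xr)// (le_trans (ler_norm _))// lerDl.
    by rewrite -ltr_pdivlMr.
  rewrite -[in `|f x|](subrK (g x) (f x)).
  have := ler_normD (f x - g x) (g x).
  by rewrite -[(f - g) x]/(f x - g x); lra.
Qed.

(** Separate a point [x0] from a closed bounded convex set by a functional. Its
ball continuity at [x0] says exactly that finitely many balls missing [x0]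
cover the set. *)
Lemma ball_continuous_BGP : (forall f, ball_continuous f) -> BGP X.
Proof.
move=> bc C cC bC /convex_setP convC.
exists [set D | finite_union_of_balls D /\ C `<=` D].
split=> [D []//|]; apply/seteqP; split=> [x Cx D [_]|x0 Dx0]; first exact.
apply: contrapT => Cx0.
suff [s [s0 sC sx0]] : exists s : seq (X * R), [/\ forall p, p \in s -> 0 < p.2,
    forall y, C y -> exists2 p, p \in s & `|y - p.1| <= p.2 &
    forall p, p \in s -> p.2 < `|x0 - p.1|].
  have [|p /= ps] := Dx0 (\bigcup_(p in [set` s]) closed_ball p.1 p.2).
    split; first by exists s.
    move=> y /sC[p ps yp]; exists p => //.
    by rewrite closed_ballE ?s0// /closed_ball_/= distrC.
  rewrite closed_ballE ?s0// /closed_ball_/= distrC.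
  by rewrite leNgt sx0.
have [C0|/set0P[y0 Cy0]] := eqVneq C set0.
  by exists [::]; split => // y; rewrite C0.
have /nbhs_ballP[d /= d0 dF] : nbhs x0 (~` C).
  by apply: open_nbhs_nbhs; split => //; exact: closed_openC.
have Cd y : C y -> d <= `|y - x0|.
  move=> Fy; rewrite leNgt; apply/negP => xyd.
  by apply: (dF y) => //; rewrite -ball_normE/= distrC.
have [|||f f1 fC] := @norm_separation _ X [set y - x0 | y in C] d.
- by exists (y0 - x0), y0.
- apply/convex_setP => _ _ t [u Cu <-] [v Cv <-] t0 t1.
  exists (t *: u + (1 - t) *: v); first exact: convC.
  by rewrite !scalerBr addrACA -opprD -scalerDl (addrC t) subrK scale1r.
- by move=> _ [y Cy <-]; exact: Cd.
have [M [_ /(_ (M + 1))]] := bC.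
rewrite ltrDl ltr01 => /(_ isT)/= CM.
have [s [s0 sP]] := bc f (M + 1 + `|x0|) d d0.
exists [seq (p.1 + x0, p.2) | p <- s]; split.
- by move=> _ /mapP[p /s0 /andP[p0 _] ->].
- move=> y Cy; apply: contrapT => ny.
  have : `|f (y - x0)| < d.
    apply: sP; first by rewrite (le_trans (ler_normB _ _))// lerD2r CM.
    move=> p ps; rewrite ltNge; apply/negP => yp; apply: ny.
    exists (p.1 + x0, p.2); first exact: (map_f (fun p => (p.1 + x0, p.2)) ps).
    by rewrite /= opprD addrCA [- p.1 + _]addrC.
  have fd : d <= f (y - x0) by apply: fC; exists y.
  by rewrite ltNge (le_trans fd)// ler_norm.
- move=> _ /mapP[p /s0 /andP[_ p1] ->] /=.
  by rewrite opprD addrCA subrr addr0 normrN.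
Qed.

Lemma seq_pos_lb (T : eqType) (h : T -> R) (s : seq T) :
  (forall p, p \in s -> 0 < h p) ->
  exists2 e, 0 < e & forall p, p \in s -> e <= h p.
Proof.
elim: s => [_|p s IH H]; first by exists 1.
have [|e e0 es] := IH; first by move=> q qs; rewrite H// in_cons qs orbT.
exists (Num.min e (h p)); first by rewrite lt_min e0 H ?mem_head.
move=> q; rewrite in_cons => /predU1P[->|/es eq].
  by rewrite ge_min lexx orbT.
by rewrite ge_min eq.
Qed.

Lemma norming_subspace_annihilator (F : set (dual X)) : norming_subspace F ->
  F <> setT -> exists2 G : dual (dual X), G <> 0 & forall f, F f -> G f = 0.
Proof. by move=> [cF _]; exact: annihilating_functional. Qed.

Lemma norming_approx (F : set (dual X)) (x : X) (e : R) : norming_subspace F ->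
  e < `|x| -> exists f, [/\ F f, `|f| <= 1 & e < f x].
Proof.
move=> [_ [_ /(_ x) Fx]]; rewrite -lte_fin Fx.
move=> /ereal_sup_gt[_ [f [Ff f1] <-]].
by rewrite lte_fin => ef; exists f.
Qed.

(** Let [G] in the bidual be a nonzero annihilator of a proper norming subspace
[F]. With [f] such that [G f = 1], the set of all [x] in the ball of radius
[`|G|] with [2^-1 <= f x] misses the origin, so finitely many balls missing the
origin cover it. For each of these balls a functional of [F] separates the
origin from it, as [F] is norming. As [G] vanishes at these functionals,
an element [v] of the set that approximates [G] on them and on [f] lies outside
every one of the balls. *)
Lemma BGP_nicely_smooth : BGP X -> nicely_smooth X.
Proof.
move=> bgp F nF; apply: contrapT => /(norming_subspace_annihilator nF)[G G0 GF].
have [f Gf] : exists f, G f = 1.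
  have [g Gg] : exists g, G g <> 0.
    apply: contrapT => nG; apply: G0; apply: dual_ext => g /=.
    by apply: contrapT => Gg; apply: nG; exists g.
  by exists ((G g)^-1 *: g); rewrite dualZ mulVf//; apply/eqP.
pose C := [set x | `|x| <= `|G| /\ 2^-1 <= f x].
have cC : closed C.
  apply: (@closedI _ [set x : X | `|x| <= `|G|] [set x | 2^-1 <= f x]).
    apply: (@closed_comp _ _ (fun x : X => `|x|) [set r | r <= `|G|]) => [x _|].
      exact: norm_continuous.
    exact: closed_le.
  apply: (@closed_comp _ _ f [set r | 2^-1 <= r]) => [x _|].
    exact: dual_continuous.
  exact: closed_ge.
have bC : bounded_set C.
  by exists `|G|; split => // M /ltW GM x [/le_trans xG _]; exact: xG.
have convC : convex_set C.
  apply/convex_setP => x y t [x1 fx] [y1 fy] t0 t1; split.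
    rewrite (le_trans (ler_normD _ _))// !normrZ.
    rewrite !ger0_norm ?subr_ge0//.
    have := ler_wpM2l t0 x1; have : 0 <= 1 - t by rewrite subr_ge0.
    by move=> /ler_wpM2l/(_ _ _ y1); lra.
  rewrite linearD/= !dualZ.
  have := ler_wpM2l t0 fx; have : 0 <= 1 - t by rewrite subr_ge0.
  by move=> /ler_wpM2l/(_ _ _ fy); lra.
have [FF [FFb CE]] := bgp C cC bC convC.
have nC0 : ~ C 0 by rewrite /C/= linear0 => -[_]; rewrite leNgt invr_gt0 ltr0n.
have [D FFD nD0] : exists2 D, FF D & ~ D 0.
  apply: contrapT => nD; apply: nC0; rewrite CE => D FFD.
  by apply: contrapT => nD0; apply: nD; exists D.
have CD : C `<=` D by rewrite CE => x; exact.
have [s [s0 DE]] := FFb _ FFD.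
have sp p : p \in s -> p.2 < `|p.1|.
  move=> ps; rewrite ltNge; apply/negP => pp; apply: nD0; rewrite DE.
  by exists p => //; rewrite closed_ballE ?s0// /closed_ball_/= subr0.
have /choice[g gP] : forall p : X * R, exists g : dual X, p \in s ->
    [/\ F g, `|g| <= 1 & p.2 < g p.1].
  move=> p; have [ps|] := boolP (p \in s); last by exists 0.
  by have [g gP] := norming_approx nF (sp _ ps); exists g.
have [|e e0 es] := @seq_pos_lb _ (fun p => g p p.1 - p.2) s.
  by move=> p /gP[_ _]; rewrite subr_gt0.
pose phi := f :: [seq g p | p <- s].
have [|v vG vphi] :=
    @goldstine _ X (size phi) (fun i => phi`_i) G (Num.min e 2^-1).
  by rewrite lt_min e0 invr_gt0 ltr0n.
have {}vphi h : h \in phi -> `|h v - G h| < Num.min e 2^-1.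
  move=> hphi; have hs : (index h phi < size phi)%N by rewrite index_mem.
  by have := vphi (Ordinal hs); rewrite /= nth_index.
have Cv : C v.
  split=> //; have := vphi f (mem_head _ _); rewrite Gf lt_min => /andP[_].
  by rewrite ltr_norml => /andP[+ _]; lra.
have := CD _ Cv; rewrite DE => -[p /= ps].
rewrite closed_ballE ?s0// /closed_ball_/=; apply/negP; rewrite -ltNge.
have [Fg g1 gp] := gP _ ps.
apply: lt_le_trans (dual_le _ g1); rewrite linearB/=.
have := vphi (g p); rewrite in_cons map_f ?orbT// GF// subr0 => /(_ isT).
rewrite lt_min => /andP[+ _]; rewrite ltr_norml => /andP[_].
by have := es _ ps; lra.
Qed.

End points.

(** * Weak*-weak continuity, separation by balls and support mappings *)

Section weak_continuity.
Context {R : realType}.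

Lemma cvg_initial (S : choiceType) (T : topologicalType) (h : S -> T)
    (F : set_system S) (s : S) : Filter F ->
  h x @[x --> F] --> h s -> F --> (s : initial_topology h).
Proof.
move=> FF hF A [_ [[C oC <-] Cs] CA]; apply: (filterS CA).
by apply: hF; exact: open_nbhs_nbhs.
Qed.

Variable X : normedModType R.

Lemma cvg_wstar (F : set_system (dual X)) (f : dual X) : Filter F ->
  (forall x, g x @[g --> F] --> f x) -> F --> (f : wstar_dual X).
Proof.
move=> FF Ff; apply: cvg_initial.
by apply/pointwise_cvgP => x; exact: Ff.
Qed.

Lemma cvg_weak (F : set_system (dual X)) (f : dual X) : Filter F ->
  (forall G : dual (dual X), G g @[g --> F] --> G f) -> F --> (f : weak_dual X).
Proof.
move=> FF Ff; apply: cvg_initial.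
by apply/pointwise_cvgP => G; exact: Ff.
Qed.

Lemma wstar_eval_continuous (x : X) :
  continuous (fun f : wstar_dual X => (f : dual X) x : R^o).
Proof.
move=> f; apply: (@continuous_comp _ _ _ (@wstar_eval R X : wstar_dual X -> _)
  (fun h : {ptws X -> R^o} => h x)).
  exact: initial_continuous.
exact: (@proj_continuous X (fun=> R^o) x).
Qed.

Lemma weak_eval_continuous (G : dual (dual X)) :
  continuous (fun f : weak_dual X => G (f : dual X) : R^o).
Proof.
move=> f; apply: (@continuous_comp _ _ _ (@weak_eval R X : weak_dual X -> _)
  (fun h : {ptws dual (dual X) -> R^o} => h G)).
  exact: initial_continuous.
exact: (@proj_continuous (dual (dual X)) (fun=> R^o) G).
Qed.

(** A slice containing [f] is a weak* neighbourhood of [f], and slices of small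
diameter give norm continuity, a fortiori weak continuity. *)
Lemma strongly_exposed_PC (f : dual X) :
  wstar_strongly_exposed (unit_ball (dual X)) f -> wstar_weak_PC X f.
Proof.
move=> /strongly_exposedP[f1 [x [fx H]]]; split => //.
apply: cvg_weak => G; apply/cvgrPdist_lt => e e0.
have G1 : 0 < `|G| + 1 by rewrite ltr_wpDl.
have [|d d0 dH] := H (e / (`|G| + 1)); first exact: divr_gt0.
have : \forall g \near nbhs (f : wstar_dual X), `|x| - d < (g : dual X) x.
  apply: (cvgr_gt _ (@wstar_eval_continuous x f)).
  by rewrite -fx; lra.
apply: filterS => g gx g1.
suff : `|G (f - g)| < e by rewrite linearB.
rewrite (le_lt_trans (ler_dual _ _))// distrC.
apply: (@le_lt_trans _ _ ((`|G| + 1) * `|g - f|)).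
  by rewrite ler_wpM2r// lerDl.
by rewrite mulrC -ltr_pdivlMr// dH.
Qed.

(** The basic weak* neighbourhoods of [f], indexed by finite lists of vectors
and radii, form a filter that converges to [f], so a weak* neighbourhood must
contain one of them. *)
Lemma PC_finite (f : dual X) (G : dual (dual X)) (e : R) :
  wstar_weak_PC X f -> 0 < e -> exists (s : seq X) (d : R), 0 < d /\
    forall g : dual X, `|g| <= 1 -> (forall x, x \in s -> `|g x - f x| < d) ->
      `|G g - G f| < e.
Proof.
move=> [f1 fPC] e0.
pose B (p : seq X * R) :=
  [set g : dual X | forall x, x \in p.1 -> `|g x - f x| < p.2].
pose D := [set p : seq X * R | 0 < p.2].
pose F := filter_from D B.
have FF : Filter F.
  apply: filter_from_filter; first by exists ([::], 1); rewrite /D/=.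
  move=> [s d] [t c] d0 c0; exists (s ++ t, Num.min d c) => [|g Hg].
    by rewrite /D/= lt_min d0 c0.
  split=> x xs; have := Hg x; rewrite mem_cat xs ?orbT lt_min.
    by move=> /(_ isT)/andP[].
  by move=> /(_ isT)/andP[].
have Ff : F --> (f : wstar_dual X).
  apply: cvg_wstar => x; apply/cvgrPdist_lt => c c0.
  by exists ([:: x], c) => // g /(_ _ (mem_head _ _)) /=; rewrite distrC.
have /fPC : nbhs (f : weak_dual X) [set g | `|G g - G f| < e].
  have /cvgrPdist_lt/(_ _ e0) := @weak_eval_continuous G f.
  by apply: filterS => g /=; rewrite distrC.
move=> /Ff[[s d] d0 sd]; exists s, d; split=> // g g1 gs.
exact: (sd g gs g1).
Qed.

Lemma bidual_emb_sum (I : Type) (r : seq I) (a : I -> R) (x : I -> X) :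
  bidual_emb (\sum_(i <- r) a i *: x i) = \sum_(i <- r) a i *: bidual_emb (x i).
Proof.
apply: dual_ext => f; rewrite bidual_embE linear_sum.
rewrite -[RHS]/(bidual_emb f _) linear_sum; apply: eq_bigr => i _.
by rewrite !linearZ.
Qed.

Lemma bidual_emb_norm_le (x : X) : `|bidual_emb x| <= `|x|.
Proof.
apply: dual_norm_le => f f1.
by rewrite bidual_embE (le_trans (ler_dual _ _))// ler_piMl.
Qed.

(** If no such [x] existed, [f] together with the value [alpha] in place of
[G f] would satisfy the compatibility condition of [helly] in the dual, for the
functionals given by [G] and any finite list of vectors of [X]. This yields
[g] in the unit ball that is weak*-close to [f] while [G g] is close to [alpha]
and away from [G f], against weak continuity at [f]. *)
Lemma PC_half_space (f : dual X) (G : dual (dual X)) (alpha : R) :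
  wstar_weak_PC X f -> alpha < G f ->
  exists x, alpha < f x - `|bidual_emb x - G|.
Proof.
move=> fPC aG; apply: contrapT => nx.
have f1 : `|f| <= 1 by case: fPC.
have H x : f x - `|bidual_emb x - G| <= alpha.
  by rewrite leNgt; apply/negP => ax; apply: nx; exists x.
pose e := (G f - alpha) / 2.
have e0 : 0 < e by rewrite divr_gt0// subr_gt0.
have [s [d [d0 sd]]] := PC_finite G fPC e0.
pose n := size s.
pose phi (i : 'I_n.+1) :=
  if unlift ord0 i is Some j then bidual_emb s`_j else G.
pose c (i : 'I_n.+1) := if unlift ord0 i is Some j then f s`_j else alpha.
have [||g g1 gP] := @helly _ (dual X) n.+1 phi c 1 (Num.min d e) ler01.
- by rewrite lt_min d0.
- move=> a; rewrite mul1r !big_ord_recl /phi /c !unlift_none.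
  under eq_bigr do rewrite liftK.
  under [in leRHS]eq_bigr do rewrite liftK.
  rewrite -bidual_emb_sum.
  have -> : \sum_(i < n) a (lift ord0 i) * f s`_i =
      f (\sum_(i < n) a (lift ord0 i) *: s`_i).
    by rewrite linear_sum; apply: eq_bigr => i _; rewrite linearZ.
  (* It remains to bound [b * alpha + f x] by the norm of [b *: G + x]. For
     [0 <= b] this follows from [alpha < G f] by evaluation at [f]; for [b < 0]
     it is a rescaling of [H]. *)
  move: (a ord0) (\sum_(i < n) a (lift ord0 i) *: s`_i) => b x {a}.
  have [b0|b0] := leP 0 b.
    have : (b *: G + bidual_emb x) f <= `|b *: G + bidual_emb x|.
      rewrite (le_trans (ler_norm _))// (le_trans (ler_dual _ _))//.
      by rewrite ler_piMr.
    rewrite -[_ f]/(b * G f + f x).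
    by have := ler_wpM2l b0 (ltW aG); lra.
  have Nb0 : 0 < - b by rewrite oppr_gt0.
  have bx : - b *: (bidual_emb ((- b)^-1 *: x) - G) = b *: G + bidual_emb x.
    apply: dual_ext => h.
    rewrite -[LHS]/(- b * (h ((- b)^-1 *: x) - G h)).
    by rewrite -[RHS]/(b * G h + h x) dualZ mulrBr mulVKf ?gt_eqF//; ring.
  rewrite -bx normrZ gtr0_norm//.
  have := H ((- b)^-1 *: x); rewrite -(ler_pM2l Nb0) mulrBr dualZ.
  by rewrite mulVKf ?gt_eqF//; lra.
have gG : `|G g - alpha| < e.
  by have := gP ord0; rewrite /phi /c unlift_none lt_min => /andP[].
have : `|G g - G f| < e.
  apply: sd => // x xs; have xn : (index x s < n)%N by rewrite index_mem.
  have := gP (lift ord0 (Ordinal xn)); rewrite /phi /c liftK /= nth_index//.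
  by rewrite lt_min => /andP[].
move: gG; rewrite !ltr_norml /e => /andP[_ ?] /andP[? _]; lra.
Qed.

(** Two distinct points of the bidual differ at a point of continuity [f]; by
[PC_half_space], the two half-spaces bounded by the hyperplane where [f] takes
the mean of the two values each contain a ball centred in [X] around one of the
points. *)
Lemma PC_separated_by_balls :
  closed_span (wstar_weak_PC X) = setT -> separated_by_balls X.
Proof.
move=> spanPC.
have sep f (F G : dual (dual X)) : wstar_weak_PC X f -> G f < F f ->
    exists (x y : X) (r s : R), [/\ 0 < r /\ 0 < s,
      closed_ball (bidual_emb x) r F, closed_ball (bidual_emb y) s G &
      closed_ball (bidual_emb x) r `&` closed_ball (bidual_emb y) s = set0].
  move=> fPC GF; have f1 : `|f| <= 1 by case: fPC.
  pose alpha := (F f + G f) / 2.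
  have [|x xF] := @PC_half_space f F alpha fPC; first by rewrite /alpha; lra.
  have [|y yG] := @PC_half_space f (- G) (- alpha) fPC.
    by rewrite -[(- G) f]/(- G f) /alpha; lra.
  have nG : `|bidual_emb (- y) - G| = `|bidual_emb y - - G|.
    rewrite opprK -normrN opprB; congr `|_|; apply: dual_ext => h.
    by rewrite -[LHS]/(G h - h (- y)) -[RHS]/(h y + G h) linearN/=; lra.
  (* The radius [s] reaches the hyperplane where [f] is [alpha], and [r] stops
     strictly short of it. *)
  pose r := (`|bidual_emb x - F| + (f x - alpha)) / 2.
  pose s := alpha + f y.
  have r0 : 0 < r by rewrite /r; have := normr_ge0 (bidual_emb x - F); lra.
  have s0 : 0 < s by rewrite /s; have := normr_ge0 (bidual_emb y - - G); lra.
  have rx : alpha < f x - r by rewrite /r; lra.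
  exists x, (- y), r, s; split => //; rewrite !closed_ballE// /closed_ball_/=.
  - by rewrite /r; lra.
  - by rewrite nG /s; lra.
  apply/seteqP; split=> // H [/= xH yH].
  have f_le (K : dual (dual X)) : K f <= `|K|.
    rewrite (le_trans (ler_norm _))// (le_trans (ler_dual _ _))//.
    by rewrite ler_piMr.
  have hx : f x - r <= H f.
    by rewrite lerBlDr -lerBlDl; exact: le_trans (f_le (bidual_emb x - H)) xH.
  have hy : H f <= alpha.
    have : H f - f (- y) <= s.
      by rewrite (le_trans (f_le (H - bidual_emb (- y))))// distrC.
    by rewrite linearN/= opprK lerD2r.
  by have := lt_le_trans rx (le_trans hx hy); rewrite ltxx.
move=> F G FG.
have [f fPC Ff] : exists2 f, wstar_weak_PC X f & F f <> G f.
  apply: contrapT => nf; apply: FG; apply: (closed_span_eq spanPC) => f fPC.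
  by apply: contrapT => Ff; apply: nf; exists f.
have [GF|FG'|/esym/Ff//] := ltgtP (G f) (F f); first exact: (sep f).
have [x [y [r [s [[r0 s0] xG yF xy]]]]] := sep f G F fPC FG'.
by exists y, x, s, r; split => //; rewrite setIC.
Qed.

(** An element [G] annihilating a norming subspace satisfies
[`|x| <= `|bidual_emb x - G|] for all [x] in [X]: every ball centred in [X] that
contains [G] contains the origin, so [G] cannot be separated from it. *)
Lemma separated_by_balls_nicely_smooth :
  separated_by_balls X -> nicely_smooth X.
Proof.
move=> sep F nF; apply: contrapT => /(norming_subspace_annihilator nF)[G G0 GF].
have [x [y [r [s [[r0 s0]]]]]] := sep _ _ G0.
rewrite !closed_ballE// /closed_ball_/= => xG y0 /seteqP[+ _] => /(_ 0); apply.
split => //=; rewrite subr0 (le_trans (bidual_emb_norm_le x))//.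
rewrite (le_trans _ xG)// leNgt; apply/negP => /(norming_approx nF)[f [Ff f1]].
apply/negP; rewrite -leNgt.
have -> : f x = (bidual_emb x - G) f.
  by rewrite -[RHS]/(f x - G f) GF// subr0.
rewrite (le_trans (ler_norm _))// (le_trans (ler_dual _ _))//.
by rewrite ler_piMr.
Qed.

(** If [a] is close to the unit vector [x], then [phi a x] is close to
[phi a a = 1]. *)
Lemma support_norming (A : set X) (phi : X -> dual X) :
  dense_in_sphere A -> support_mapping phi ->
  norming_subspace (closed_span (phi @` A)).
Proof.
move=> [AS SA] phiS; split; first exact: closed_span_closed_subspace.
split=> [f []//|x]; apply/le_anti/andP; split; last first.
  by apply: ge_ereal_sup => _ [f [_ f1] <-]; rewrite lee_fin dual_le.
have [->|x0] := eqVneq x 0.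
  rewrite normr0; apply: ereal_sup_ubound; exists 0 => //.
  have /closed_subspaceP[? _ _] := closed_span_closed_subspace (phi @` A).
  by split=> //; rewrite /unit_ball/= normr0.
have nx0 : 0 < `|x| by rewrite normr_gt0.
apply/lee_subgt0Pr => e e0.
have : closure A (`|x|^-1 *: x).
  by apply: SA; rewrite /unit_sphere/= normrZ normfV normr_id mulVf ?gt_eqF.
have ex0 : 0 < e / `|x| by rewrite divr_gt0.
move=> /(_ _ (nbhsx_ballx _ _ ex0))[a [Aa]]; rewrite -ball_normE/= => xa.
have [phia1 phiaa] := phiS a (AS _ Aa).
have phia : `|phi a| <= 1 by rewrite phia1.
apply: (@le_trans _ _ (phi a x)%:E); last first.
  apply: ereal_sup_ubound; exists (phi a) => //; split => //.
  by apply: sub_closed_span; exists a.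
have := dual_ge (`|x|^-1 *: x - a) phia.
rewrite linearB/= dualZ phiaa => xpa.
have : 1 - e / `|x| <= `|x|^-1 * phi a x by lra.
rewrite -(ler_pM2l nx0) mulVKf ?gt_eqF// mulrBr mulr1 mulrCA.
rewrite divff ?gt_eqF// mulr1.
by rewrite -EFinB lee_fin.
Qed.

Lemma nicely_smooth_support : nicely_smooth X ->
  forall (A : set X) (phi : X -> dual X),
    dense_in_sphere A -> support_mapping phi -> separates_bidual (phi @` A).
Proof.
move=> ns A phi dA sphi F G FG; apply: contrapT => nf; apply: FG.
apply: (closed_span_eq (ns _ (support_norming dA sphi))) => f Af.
by apply: contrapT => Ff; apply: nf; exists f.
Qed.

Lemma separates_closed_span (A : set (dual X)) :
  separates_bidual A -> closed_span A = setT.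
Proof.
move=> sepA; apply: contrapT.
move=> /(annihilating_functional (closed_span_closed_subspace A))[G G0 GA].
by have [f /sub_closed_span/GA] := sepA _ _ G0.
Qed.

End weak_continuity.

(** * Smooth points of the norm *)

Section smooth_points.
Context {R : realType}.

Section normed.
Variable X : normedModType R.

(** An [e]-approximate form of Frechet differentiability of the norm at [x], in
which the approximate derivative [g] may depend on [e]. *)
Definition smooth_point (x : X) := forall e : R, 0 < e ->
  exists (g : dual X) (s : R), 0 < s /\
    forall y, `|y| <= s -> `|x + y| <= `|x| + g y + e * `|y|.

(** Smulian's argument: every [h] in the dual unit ball that almost attains
[`|x|] at [x] satisfies [(h - g) y <= `|x| - h x + e * `|y|] for small [y], and
so is close to [g] in norm. *)
Lemma smooth_point_strongly_exposed (x : X) (f : dual X) :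
  smooth_point x -> `|f| <= 1 -> f x = `|x| ->
  wstar_strongly_exposed (unit_ball (dual X)) f.
Proof.
move=> sx f1 fx; apply/strongly_exposedP; split => //.
exists x; split=> // e e0.
have [|g [s [s0 sg]]] := sx (e / 5); first by rewrite divr_gt0.
(* The value [5] leaves room for the distance [2 * (e / 5)] from [g] to each of
   [h] and [f]. *)
have near_g (h : dual X) : `|h| <= 1 -> `|x| - e / 5 * s < h x ->
    `|h - g| <= 2 * (e / 5).
  move=> h1 hx; have half z : `|z| <= 1 -> (h - g) z <= 2 * (e / 5).
    move=> z1; have sz : `|s *: z| <= s.
      by rewrite normrZ gtr0_norm// ger_pMr.
    rewrite -(ler_pM2l s0) -dualZ -[(h - g) _]/(h (s *: z) - g (s *: z)).
    have := dual_le (x + s *: z) h1; rewrite linearD/=.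
    have := sg _ sz; have := ler_wpM2l (ltW (divr_gt0 e0 (ltr0n R 5))) sz.
    by lra.
  apply: dual_norm_le => z z1.
  by rewrite ler_norml lerNl -linearN !half// normrN.
have d0 : 0 < e / 5 * s by rewrite mulr_gt0// divr_gt0.
exists (e / 5 * s) => // h h1 hx.
have fg : `|f - g| <= 2 * (e / 5) by apply: near_g => //; rewrite fx; lra.
have := near_g _ h1 hx; rewrite -[h - f](subrKA g).
have := ler_normD (h - g) (g - f); rewrite [`|g - f|]distrC.
by move: fg; move: (normr (_ + _)) (normr (h - g)) (normr _) => a b c; lra.
Qed.

Lemma differentiable_smooth_point (x : X) :
  differentiable (fun x : X => `|x| : R^o) x -> smooth_point x.
Proof.
move=> dx e e0.
pose d : X -> R^o := 'd (fun x : X => `|x| : R^o) x.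
have dp : dual_pred d.
  by apply/asboolP; split; [exact: linearP|exact: diff_continuous].
have /eqaddoP/(_ _ e0) := diff_locally dx.
move=> /nbhs_ballP[s /= s0 sP]; exists (Dual dp), (s / 2); split.
  by rewrite divr_gt0.
move=> y ys; have := sP y.
rewrite -ball_normE/= sub0r normrN => /(_ _)/wrap[]; first by lra.
move=> /(le_trans (ler_norm _)).
rewrite -[(_ - _) y]/(`|y + x| - (`|x| + d y)) (addrC y x).
rewrite -[X in _ <= X -> _]/(e * `|y|) -[X in _ -> _ <= _ + X + _]/(d y).
by lra.
Qed.

Lemma normalized_dense (D : set X) : dense D ->
  dense_in_sphere [set `|x|^-1 *: x | x in D `&` [set x | x != 0]].
Proof.
move=> dD; split=> [_ [x [Dx /= x0] <-]|x x1 B /nbhs_ballP[e /= e0 eB]].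
  by rewrite /unit_sphere/= normrZ normfV normr_id mulVf// normr_eq0.
pose d := Num.min 1 (e / 2).
have d0 : 0 < d by rewrite lt_min ltr01 divr_gt0.
have [a []] : ball x d `&` D !=set0.
  by apply: dD; [exists x; exact: ballxx|exact: ball_open].
rewrite -ball_normE/= lt_min => /andP[xa1 xae] Da.
have na : 0 < `|a|.
  by have := ler_normD (x - a) a; rewrite subrK x1; lra.
exists (`|a|^-1 *: a); split.
  by exists a => //; split=> //=; rewrite -normr_gt0.
apply: eB; rewrite -ball_normE/=.
have aa : `|a - `|a|^-1 *: a| = `| `|a| - 1 |.
  rewrite -[X in X - _]scale1r -scalerBl normrZ -[X in _ * X]gtr0_norm//.
  by rewrite -normrM mulrBl mul1r mulVf ?gt_eqF.
rewrite -[x - _](subrKA a) (le_lt_trans (ler_normD _ _))// aa.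
have : `| `|a| - 1 | <= `|x - a|.
  by rewrite -x1 distrC ler_dist_dist.
lra.
Qed.

Lemma support_mapping_exists : exists phi : X -> dual X, support_mapping phi.
Proof.
have /choice[phi phiP] :
    forall x : X, exists f : dual X, `|f| <= 1 /\ f x = `|x|.
  by move=> x; have [f f1 fx] := norm_attaining_functional x; exists f.
exists phi => x x1; have [f1 fx] := phiP x; split; last by rewrite fx x1.
apply/le_anti; rewrite f1/=.
by have := ler_dual (phi x) x; rewrite fx x1 mulr1 normr1.
Qed.

Definition support_spanning := forall (A : set X) (phi : X -> dual X),
  dense_in_sphere A -> support_mapping phi -> closed_span (phi @` A) = setT.

(** A support functional at the normalization of a smooth point is strongly
exposed, and these functionals span the dual, since the normalized smooth
points are dense in the sphere. *)
Lemma smooth_dense_strongly_exposed : dense (smooth_point : set X) ->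
  support_spanning ->
  closed_span (wstar_strongly_exposed (unit_ball (dual X))) = setT.
Proof.
move=> dS sp; have [phi phiS] := support_mapping_exists.
apply: closed_span_setTS (sp _ phi (normalized_dense dS) phiS).
move=> _ [_ [x [sx /= x0] <-] <-].
have nx : 0 < `|x| by rewrite normr_gt0.
have [|f1 fx] := phiS (`|x|^-1 *: x).
  by rewrite /unit_sphere/= normrZ normfV normr_id mulVf// gt_eqF.
apply: (smooth_point_strongly_exposed sx); first by rewrite f1.
by move: fx; rewrite dualZ => /(canRL (mulVKf (lt0r_neq0 nx))); rewrite mulr1.
Qed.

Lemma asplund_smooth_dense : asplund X -> dense (smooth_point : set X).
Proof.
move=> /(_ setT (fun x => `|x|)) [].
- exact: openT.
- by exists 0.
- by move=> x y t _ _; rewrite inE.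
- by apply: continuous_subspaceT => x; exact: norm_continuous.
- move=> t x y _ _ /=.
  rewrite (le_trans (ler_normD _ _))// !normrZ.
  by rewrite !ger0_norm ?subr_ge0.
move=> G [_ _ Gcl Gd] O [x Ox] oO.
have [y [Gy Oy]] := Gcl x I O (open_nbhs_nbhs (conj oO Ox)).
by exists y; split => //; apply: differentiable_smooth_point; exact: Gd.
Qed.

(** The sequence enumerates the finite rational linear combinations of the
[h n]. *)
Lemma countable_span_dense (h : nat -> dual X) : closed_span (range h) = setT ->
  exists g : nat -> dual X, forall f e, 0 < e -> exists n, `|f - g n| < e.
Proof.
move=> hT.
pose comb (s : seq (rat * nat)) : dual X := \sum_(p <- s) ratr p.1 *: h p.2.
exists (fun n => comb (odflt [::] (unpickle n))) => f e e0.
suff [s fs] : exists s, `|f - comb s| < e by exists (pickle s); rewrite pickleK.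
suff clT : closed_subspace (closure (range comb)).
  have : closure (range comb) f.
    have : closed_span (range h) f by rewrite hT.
    apply: closed_span_sub => // _ [n _ <-].
    apply: subset_closure; exists [:: (1, n)] => //.
    by rewrite /comb big_seq1 rmorph1 scale1r.
  move=> /(_ _ (nbhsx_ballx _ _ e0))[_ [[s _ <-]]].
  by rewrite -ball_normE/=; exists s.
have approx (u : dual X) : closure (range comb) u <->
    forall e, 0 < e -> exists s, `|u - comb s| < e.
  split=> [cu c c0|H B /nbhs_ballP[c /= /H[s us] cB]].
    have [_ [[s _ <-]]] := cu _ (nbhsx_ballx _ _ c0).
    by rewrite -ball_normE/=; exists s.
  by exists (comb s); split; [exists s|apply: cB; rewrite -ball_normE].
apply/closed_subspaceP; split.
- by apply: subset_closure; exists [::] => //; rewrite /comb big_nil.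
- move=> a u v /approx cu /approx cv; apply/approx => c c0.
  have a1 : 0 < `|a| + 1 by rewrite ltr_wpDl.
  have [|s us] := cu (c / 3 / (`|a| + 1)); first by rewrite !divr_gt0.
  have [|t vt] := cv (c / 3); first by rewrite divr_gt0.
  have s1 : 0 < `|comb s| + 1 by rewrite ltr_wpDl.
  have [q aq] : exists q : rat, `|a - ratr q| < c / 3 / (`|comb s| + 1).
    have d0 : 0 < c / 3 / (`|comb s| + 1) by rewrite !divr_gt0.
    have [|q] := @rat_in_itvoo R (a - c / 3 / (`|comb s| + 1))
      (a + c / 3 / (`|comb s| + 1)); first by lra.
    by rewrite in_itv/= => aq; exists q; rewrite ltr_distlC.
  exists ([seq (q * p.1, p.2) | p <- s] ++ t).
  have -> : comb ([seq (q * p.1, p.2) | p <- s] ++ t) =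
      ratr q *: comb s + comb t.
    rewrite /comb big_cat big_map scaler_sumr; congr (_ + _).
    by apply: eq_bigr => p _; rewrite scalerA rmorphM.
  have -> : a *: u + v - (ratr q *: comb s + comb t) =
      a *: (u - comb s) + (a - ratr q) *: comb s + (v - comb t).
    rewrite scalerBr scalerBl opprD addrACA; congr (_ + _).
    by rewrite addrA subrK.
  rewrite (le_lt_trans (ler_normD _ _))//.
  have := ler_normD (a *: (u - comb s)) ((a - ratr q) *: comb s).
  rewrite !normrZ.
  have : `|a| * `|u - comb s| <= c / 3.
    apply: (@le_trans _ _ ((`|a| + 1) * `|u - comb s|)).
      by rewrite ler_wpM2r// lerDl.
    by rewrite mulrC -ler_pdivlMr// ltW.
  have : `|a - ratr q| * `|comb s| <= c / 3.
    apply: (@le_trans _ _ (`|a - ratr q| * (`|comb s| + 1))).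
      by rewrite ler_wpM2l// lerDl.
    by rewrite -ler_pdivlMr// ltW.
  lra.
- exact: closed_closure.
Qed.

(** A countable dense subset of the sphere has countably many support
functionals, and these span the dual. *)
Lemma separable_dual : separable X -> support_spanning ->
  exists g : nat -> dual X, forall f e, 0 < e -> exists n, `|f - g n| < e.
Proof.
move=> [A [cA dA]] sp; have [phi phiS] := support_mapping_exists.
have := sp _ phi (normalized_dense dA) phiS.
have [h hA] : exists h : nat -> dual X,
    phi @` [set `|x|^-1 *: x | x in A `&` [set x | x != 0]] `<=` range h.
  have /countable_injP[i iinj] := cA.
  pose B n x := A x /\ i x = n.
  exists (fun n => phi (`|get (B n)|^-1 *: get (B n))).
  move=> _ [_ [x [Ax _] <-] <-]; exists (i x) => //.
  have [Ag ig] : B (i x) (get (B (i x))) by apply: getPex; exists x.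
  by rewrite (iinj _ _ _ _ ig) ?inE.
move=> /(closed_span_setTS hA); exact: countable_span_dense.
Qed.

End normed.

(** For [p = (k, j)], the set [A p] below consists of the [x] at which the norm
has a support functional within [1 / (j + 1)] of [g k]; the inequality that
defines it is the Hahn-Banach condition for such a functional to exist, and it
is visibly closed in [x]. For each [j] the sets [A (k, j)] cover [X] because the
[g k] are dense. An interior point of [A (k, j)] satisfies the estimate of
[smooth_point] with error [1 / (j + 1)], and by Baire's theorem the points that
lie on the boundary of no [A p] are dense. *)
Lemma separable_dual_smooth_dense (X : completeNormedModType R)
    (g : nat -> dual X) : (forall f e, 0 < e -> exists n, `|f - g n| < e) ->
  dense (@smooth_point X : set X).
Proof.
move=> gd.
pose A (p : nat * nat) := [set x : X | forall u : X,
  `|x| <= `|x - u| + g p.1 u + p.2.+1%:R^-1 * `|u|].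
have cA p : closed (A p).
  rewrite (_ : A p = \bigcap_u [set x : X | `|x| - `|x - u| <=
      g p.1 u + p.2.+1%:R^-1 * `|u|]); last first.
    apply/seteqP; split=> x Ax u.
      by move=> _ /=; rewrite lerBlDl addrA; exact: Ax.
    by rewrite -addrA -lerBlDl; exact: Ax.
  apply: closed_bigI => u _.
  apply: (@closed_comp _ _ (fun x : X => `|x| - `|x - u|)
    [set r | r <= _]) => [x _|].
    apply: cvgB; first exact: norm_continuous.
    apply: cvg_norm; apply: cvgB; [exact: cvg_id|exact: cvg_cst].
  exact: closed_le.
pose F n := let p := odflt (0, 0)%N (unpickle n) in (A p)° `|` ~` A p.
have /Baire dF : forall n, open (F n) /\ dense (F n).
  move=> n; rewrite /F; case: (odflt _ _) => k j; split.
    by apply: openU; [exact: open_interior|exact: closed_openC].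
  move=> O [x Ox] oO.
  have [OA|] := pselect (O `<=` A (k, j)).
    exists x; split => //; left; apply: filterS OA _.
    by apply: open_nbhs_nbhs; split.
  by move=> /existsNP[y /not_implyP[Oy Ay]]; exists y; split => //; right.
move=> O O0 oO; have [x [Ox Fx]] := dF O O0 oO.
exists x; split=> // e e0.
have [j je] : exists j : nat, j.+1%:R^-1 < e.
  by have [j _ /(_ j (leqnn j))] := near_infty_natSinv_lt (PosNum e0); exists j.
have [f f1 fx] := norm_attaining_functional x.
have j0 : (0 : R) < j.+1%:R^-1 by rewrite invr_gt0.
have [k fk] := gd f _ j0.
have Ax : A (k, j) x.
  move=> u /=; have := dual_le (x - u) f1; rewrite linearB/= fx.
  have := ler_dual (f - g k) u.
  have := ler_wpM2r (normr_ge0 u) (ltW fk).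
  have := ler_norm ((f - g k) u).
  rewrite -[(f - g k) u]/(f u - g k u).
  by move: (j.+1%:R^-1 * _) (`|f - g k| * _) => c b; lra.
have := Fx (pickle (k, j)) I; rewrite /F pickleK/= => -[|//].
move=> /nbhs_ballP[s /= s0 sA].
exists (g k), (s / 2); split; first by rewrite divr_gt0.
move=> y ys; have xys : ball x s (x + y).
  by rewrite -ball_normE/= opprD addrA subrr sub0r normrN; lra.
rewrite (le_trans (sA _ xys y))// addrK lerD2l.
by rewrite ler_wpM2r// ltW.
Qed.

Lemma support_spanning_strongly_exposed (X : completeNormedModType R) :
  asplund X \/ separable X -> support_spanning X ->
  closed_span (wstar_strongly_exposed (unit_ball (dual X))) = setT.
Proof.
move=> [aX|sX] sp; apply: smooth_dense_strongly_exposed => //.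
  exact: asplund_smooth_dense.
by have [g gd] := separable_dual sX sp; exact: separable_dual_smooth_dense gd.
Qed.

End smooth_points.

(** * Equivalence of the characterizations *)

Theorem corollary6 (R : realType) (X : completeNormedModType R)
    (hX : asplund X \/ separable X) :
  [<-> closed_span (wstar_strongly_exposed (unit_ball (dual X))) = setT;
       closed_span (wstar_denting (unit_ball (dual X))) = setT;
       closed_span (wstar_SCS (unit_ball (dual X))) = setT;
       BGP X;
       nicely_smooth X]
  /\
  [<-> closed_span (wstar_weak_PC X) = setT;
       separated_by_balls X;
       nicely_smooth X;
       forall (A : set X) (phi : X -> dual X),
         dense_in_sphere A -> support_mapping phi ->
         separates_bidual (phi @` A)].
Proof.
have sep_exposed : (forall (A : set X) (phi : X -> dual X),
    dense_in_sphere A -> support_mapping phi -> separates_bidual (phi @` A)) ->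
    closed_span (wstar_strongly_exposed (unit_ball (dual X))) = setT.
  move=> sepA; apply: support_spanning_strongly_exposed => // A phi dA sphi.
  by apply: separates_closed_span; exact: sepA.
split; tfae.
- by apply: closed_span_setTS => f; exact: strongly_exposed_denting.
- by apply: closed_span_setTS => f; exact: denting_SCS.
- move=> spanSCS; apply: ball_continuous_BGP => f.
  have := closed_span_sub (@ball_continuous_closed_subspace _ X)
    (@SCS_ball_continuous _ X).
  by rewrite spanSCS; exact.
- exact: BGP_nicely_smooth.
- by move=> /nicely_smooth_support; exact: sep_exposed.
- exact: PC_separated_by_balls.
- exact: separated_by_balls_nicely_smooth.
- exact: nicely_smooth_support.
- move=> /sep_exposed; apply: closed_span_setTS => f.
  exact: strongly_exposed_PC.
Qed.
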